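(* Let $a\in\mathbb{I}_1\setminus K$. Then the following statements are equivalent: (1) $a\notin K[H]+F$. (2) $\mathrm{Cen}_{\mathbb{I}_1}(a)$ is a finitely generated $K[a]$-module. (3) $\mathrm{Cen}_{\mathbb{I}_1}(a)$ is a left Noetherian algebra. (4) $\mathrm{Cen}_{\mathbb{I}_1}(a)$ is a right Noetherian algebra. (5) $\mathrm{Cen}_{\mathbb{I}_1}(a)$ is a finitely generated and Noetherian algebra.
   Context: $K$ is a field of characteristic zero. $\mathbb{I}_1$ is the subalgebra of $\mathrm{End}_K(K[x])$ generated by (multiplication by) $x$, $\partial=\frac{d}{dx}$ and $\int: x^n\mapsto \frac{x^{n+1}}{n+1}$. Put $H:=\partial x$, $e_{ij}:=\int^i\partial^j-\int^{i+1}\partial^{j+1}$ ($i,j\ge0$) and $F:=\bigoplus_{i,j\ge0}Ke_{ij}$, an ideal of $\mathbb{I}_1$. $\mathrm{Cen}_{\mathbb{I}_1}(a)$ is the centralizer of $a$ in $\mathbb{I}_1$ and $K[a]$ is the subalgebra generated by $a$. Noetherian means left and right Noetherian. *)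

(* Defs.v *)
From HB Require Import structures.
From mathcomp Require Import all_boot all_order all_algebra all_classical.

Set Implicit Arguments.
Unset Strict Implicit.
Unset Printing Implicit Defensive.

Import GRing.Theory.
Local Open Scope ring_scope.
Local Open Scope classical_set_scope.

(* The K-algebra End_K(K[x]), with product (f * g) p = f (g p). *)
Definition polyEnd (K : fieldType) := {linear {poly K} -> {poly K}}.

Section PolyEnd.
Context (K : fieldType).
Implicit Types f g h : polyEnd K.

HB.instance Definition _ := gen_eqMixin (polyEnd K).
HB.instance Definition _ := gen_choiceMixin (polyEnd K).

Lemma polyEnd_ext f g : f =1 g -> f = g.
Proof.
case: f g => [f [[fD] [fZ]]] [g [[gD] [gZ]]] /= /funext fg.
move: fD fZ gD gZ; rewrite {}fg => fD fZ gD gZ.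
by rewrite (Prop_irrelevance fD gD) (Prop_irrelevance fZ gZ).
Qed.

Definition polyEnd_zero : polyEnd K := \0 : {linear {poly K} -> {poly K}}.
Definition polyEnd_opp f : polyEnd K := \- f : {linear {poly K} -> {poly K}}.
Definition polyEnd_add f g : polyEnd K :=
  f \+ g : {linear {poly K} -> {poly K}}.
Definition polyEnd_one : polyEnd K := idfun : {linear {poly K} -> {poly K}}.
Definition polyEnd_mul f g : polyEnd K :=
  f \o g : {linear {poly K} -> {poly K}}.

Lemma polyEnd_addA : associative polyEnd_add.
Proof. by move=> f g h; apply: polyEnd_ext => p /=; rewrite addrA. Qed.

Lemma polyEnd_addC : commutative polyEnd_add.
Proof. by move=> f g; apply: polyEnd_ext => p /=; rewrite addrC. Qed.

Lemma polyEnd_add0 : left_id polyEnd_zero polyEnd_add.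
Proof. by move=> f; apply: polyEnd_ext => p /=; rewrite add0r. Qed.

Lemma polyEnd_addN : left_inverse polyEnd_zero polyEnd_opp polyEnd_add.
Proof. by move=> f; apply: polyEnd_ext => p /=; rewrite addNr. Qed.

HB.instance Definition _ :=
  GRing.isZmodule.Build (polyEnd K)
    polyEnd_addA polyEnd_addC polyEnd_add0 polyEnd_addN.

Lemma polyEnd_mulA : associative polyEnd_mul.
Proof. by move=> f g h; apply: polyEnd_ext. Qed.

Lemma polyEnd_mul1 : left_id polyEnd_one polyEnd_mul.
Proof. by move=> f; apply: polyEnd_ext. Qed.

Lemma polyEnd_mulr1 : right_id polyEnd_one polyEnd_mul.
Proof. by move=> f; apply: polyEnd_ext. Qed.

Lemma polyEnd_mulDl : left_distributive polyEnd_mul +%R.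
Proof. by move=> f g h; apply: polyEnd_ext. Qed.

Lemma polyEnd_mulDr : right_distributive polyEnd_mul +%R.
Proof. by move=> f g h; apply: polyEnd_ext => p /=; rewrite linearD. Qed.

HB.instance Definition _ := GRing.Zmodule_isPzRing.Build (polyEnd K)
  polyEnd_mulA polyEnd_mul1 polyEnd_mulr1 polyEnd_mulDl polyEnd_mulDr.
Lemma polyEnd_one_neq0 : (1 : polyEnd K) != 0.
Proof.
apply/eqP => /(congr1 (fun f : polyEnd K => f 1)) /= /eqP.
by rewrite (oner_eq0 {poly K}).
Qed.

HB.instance Definition _ :=
  GRing.PzSemiRing_isNonZero.Build (polyEnd K) polyEnd_one_neq0.

Definition polyEnd_scale (c : K) f : polyEnd K :=
  c \*: f : {linear {poly K} -> {poly K}}.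

Lemma polyEnd_scaleA (a b : K) f :
  polyEnd_scale a (polyEnd_scale b f) = polyEnd_scale (a * b) f.
Proof. by apply: polyEnd_ext => p /=; rewrite scalerA. Qed.

Lemma polyEnd_scale1 : left_id 1 polyEnd_scale.
Proof. by move=> f; apply: polyEnd_ext => p /=; rewrite scale1r. Qed.

Lemma polyEnd_scaleDr : right_distributive polyEnd_scale +%R.
Proof. by move=> c f g; apply: polyEnd_ext => p /=; rewrite scalerDr. Qed.

Lemma polyEnd_scaleDl f : {morph polyEnd_scale^~ f : a b / a + b}.
Proof. by move=> a b; apply: polyEnd_ext => p /=; rewrite scalerDl. Qed.

HB.instance Definition _ := GRing.Zmodule_isLmodule.Build K (polyEnd K)
  polyEnd_scaleA polyEnd_scale1 polyEnd_scaleDr polyEnd_scaleDl.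

Lemma polyEnd_scaleAl (c : K) f g : c *: (f * g) = (c *: f) * g.
Proof. by apply: polyEnd_ext. Qed.

HB.instance Definition _ :=
  GRing.LSemiModule_isLSemiAlgebra.Build K (polyEnd K) polyEnd_scaleAl.

Lemma polyEnd_scaleAr (c : K) f g : c *: (f * g) = f * (c *: g).
Proof. by apply: polyEnd_ext => p /=; rewrite linearZ. Qed.

HB.instance Definition _ :=
  GRing.Lalgebra_isAlgebra.Build K (polyEnd K) polyEnd_scaleAr.
End PolyEnd.

(* Subalgebras of a K-algebra A, and subspaces, ideals and subsets of them,   *)
(* are all represented as classical sets of elements of A.                    *)
Section Subalgebras.
Context (K : pzRingType) (A : algType K).
Implicit Types (a b : A) (B C I M S : set A).

Definition subalg_gen S : set A :=
  smallest [set B | GRing.subalg_closed (mem B)] S.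

Definition lin_span S : set A :=
  smallest [set M | GRing.submod_closed (mem M)] S.

Definition sum_set M N : set A := [set u + v | u in M & v in N].

Definition centralizer B a : set A := B `&` [set b | GRing.comm a b].

(* B acts on M by left multiplication; when B is a subalgebra, taking         *)
(* coefficients 0 and 1 shows that the generators m i lie in M.               *)
Definition fingen_module B M : Prop :=
  exists (n : nat) (m : 'I_n -> A),
    M = [set b | exists2 r : 'I_n -> A,
                   (forall i, B (r i)) & b = \sum_(i < n) r i * m i].

Definition fingen_algebra B : Prop :=
  exists s : seq A, B = subalg_gen [set` s].

Definition left_ideal B I : Prop :=
  [/\ I `<=` B, GRing.zmod_closed (mem I) &
      forall b u, B b -> I u -> I (b * u)].

Definition right_ideal B I : Prop :=
  [/\ I `<=` B, GRing.zmod_closed (mem I) &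
      forall b u, B b -> I u -> I (u * b)].

Definition ascending_chain_condition (P : set A -> Prop) : Prop :=
  forall I_ : nat -> set A,
    (forall n, P (I_ n)) -> (forall n, I_ n `<=` I_ n.+1) ->
    exists N, forall n, (N <= n)%N -> I_ n = I_ N.

Definition left_noetherian B := ascending_chain_condition (left_ideal B).

Definition right_noetherian B := ascending_chain_condition (right_ideal B).

Definition noetherian B := left_noetherian B /\ right_noetherian B.
End Subalgebras.

Section IntegroDifferential.
Context (K : fieldType).

Definition mulx_poly (p : {poly K}) : {poly K} := 'X * p.

Lemma mulx_poly_linear : linear mulx_poly.
Proof. by move=> c p q; rewrite /mulx_poly mulrDr scalerAr. Qed.

HB.instance Definition _ :=
  GRing.isLinear.Build K {poly K} {poly K} _ mulx_poly mulx_poly_linear.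

Definition int_poly (p : {poly K}) : {poly K} :=
  \sum_(i < size p) (p`_i / i.+1%:R) *: 'X^(i.+1).

Lemma coef_int_poly p i :
  (int_poly p)`_i = if i is j.+1 then p`_j / j.+1%:R else 0.
Proof.
rewrite coef_sum; under eq_bigr do rewrite coefZ coefXn.
case: i => [|j]; first by rewrite big1 // => k _; rewrite mulr0.
have [jp|pj] := ltnP j (size p); last first.
  rewrite nth_default // mul0r big1 // => k _.
  by rewrite eqSS gtn_eqF ?mulr0 // (leq_trans (ltn_ord k)).
rewrite (bigD1 (Ordinal jp)) //= eqxx mulr1 big1 ?addr0 // => k nk.
rewrite eqSS eq_sym -[j]/(val (Ordinal jp)) (inj_eq val_inj).
by rewrite (negPf nk) mulr0.
Qed.

Lemma int_poly_linear : linear int_poly.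
Proof.
move=> c p q; apply/polyP=> -[|i]; rewrite coefD coefZ !coef_int_poly.
  by rewrite mulr0 addr0.
by rewrite coefD coefZ mulrDl mulrA.
Qed.

HB.instance Definition _ :=
  GRing.isLinear.Build K {poly K} {poly K} _ int_poly int_poly_linear.

Lemma int_polyXn n : int_poly 'X^n = n.+1%:R^-1 *: 'X^(n.+1).
Proof.
apply/polyP=> -[|i]; rewrite coef_int_poly coefZ !coefXn ?mulr0 // eqSS.
by have [->|_] := eqVneq i n; rewrite ?mul1r ?mulr1 ?mul0r ?mulr0.
Qed.

Definition op_x : polyEnd K := mulx_poly : {linear {poly K} -> {poly K}}.
Definition op_d : polyEnd K := (@deriv K) : {linear {poly K} -> {poly K}}.
Definition op_int : polyEnd K := int_poly : {linear {poly K} -> {poly K}}.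

Definition I1 : set (polyEnd K) := subalg_gen [set op_x; op_d; op_int].

Definition op_H : polyEnd K := op_d * op_x.

Definition op_e (i j : nat) : polyEnd K :=
  op_int ^+ i * op_d ^+ j - op_int ^+ i.+1 * op_d ^+ j.+1.

Definition idealF : set (polyEnd K) :=
  lin_span [set op_e ij.1 ij.2 | ij in [set: nat * nat]].
End IntegroDifferential.

Arguments I1 : clear implicits.
Arguments op_H : clear implicits.
Arguments idealF : clear implicits.

(* Main.v *)
Require Import Defs.
From mathcomp Require Import all_boot all_order all_algebra all_classical.

Set Implicit Arguments.
Unset Strict Implicit.
Unset Printing Implicit Defensive.

Import GRing.Theory.
Local Open Scope ring_scope.
Local Open Scope classical_set_scope.

(** Read an operator on [{poly K}] as its infinite matrix in the basis of
    divided powers ['X^n / n!].  There [op_d] and [op_int] are the two shifts,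
    transposes of each other, [op_H] is diagonal, and every element of [I1] has
    a banded matrix whose diagonals are eventually given by polynomials
    ([I1_evpoly]).  If all these polynomials except that of the main diagonal
    vanish, the operator lies in [K[H] + F] ([diagonal_sum_HF]).

    So suppose that [a] is not in [K[H] + F]: some other diagonal has a nonzero
    polynomial.  If one below the main diagonal does, then [a] raises the degree
    of every large power ['X^n] by the same [d > 0], because a nonzero
    polynomial has finitely many roots in the natural numbers.  Division by
    leading terms then shows that finitely many powers ['X^i], [i < s], generate
    [{poly K}] over [K[a]].  An operator commuting with [a] is determined by its
    values on these generators, so the centralizer embeds [K[a]]-linearly in
    the finitely generated [K[a]]-module [{poly K}^s].  It is then finitely
    generated itself, because [K[a]] is a quotient of the principal ideal domain
    of polynomials in one variable ([raises_degree_module_finite]).  If the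
    diagonal lies above the main one, the same argument applies to the transpose
    of [a] and to the transposes of the operators commuting with it
    ([module_finite_adjoint]).

    Once the centralizer is a finite [K[a]]-module, it is a finitely generated
    algebra, and since [a] is central in it, its left and its right ideals are
    [K[a]]-submodules, so that both chain conditions hold
    ([module_finite_noetherian]).

    Conversely, an element of [K[H] + F] commutes with all but finitely many of
    the orthogonal idempotents [e_nn] ([comm_HF_diag]), and the annihilators of
    the tails of this family form strictly increasing chains of left and of
    right ideals of the centralizer. *)

(** * Submodules of finite free modules over [{poly K}] *)

Section PolyModules.
Context (K : fieldType).

(** Every submodule that finitely many linear forms separate, hence every
    submodule of a finite free module, is finitely generated.  Induction on the
    number of forms: the values of the first form are multiples of a nonzero
    value of least degree, and subtracting a multiple of a vector attaining it
    leads to the kernel of that form. *)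
Lemma submodule_fingen (V : lmodType {poly K}) (I : eqType)
    (phi : I -> V -> {poly K}) (s : seq I) (U : set V) :
  (forall i, scalar (phi i)) ->
  GRing.submod_closed (mem U) ->
  (forall u, U u -> {in s, forall i, phi i u = 0} -> u = 0) ->
  exists g : seq V, {in g, forall u, U u} /\
    forall u, U u -> exists r : nat -> {poly K},
      u = \sum_(i < size g) r i *: g`_i.
Proof.
move=> phi_lin; elim: s U => [|i s IHs] U [U0 Ulin] U_inj.
  exists [::]; split=> // u Uu; exists (fun=> 0).
  by rewrite big_ord0 (U_inj u).
have phiP r u v : phi i (r *: u + v) = r * phi i u + phi i v.
  exact: phi_lin.
have phi0 : phi i 0 = 0.
  by have := phiP (-1) 0 0; rewrite scaler0 addr0 mulN1r addNr.
have {}U0 : U 0 by move: U0; rewrite inE.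
have {}Ulin r u v : U u -> U v -> U (r *: u + v).
  by move=> Uu Uv; have := Ulin r u v; rewrite !inE; apply.
pose U' := [set u | U u /\ phi i u = 0].
have [||g' [Ug' gen_g']] := IHs U'.
- split; first by rewrite inE; split.
  move=> r u v; rewrite !inE => -[Uu u0] [Uv v0]; split; first exact: Ulin.
  by rewrite phiP u0 v0 mulr0 addr0.
- move=> u [Uu u0] s0; apply: U_inj => // j.
  by rewrite in_cons => /predU1P[->//|/s0].
have [nz|/forallNP z] := pselect (exists u, U u /\ phi i u != 0); last first.
  exists g'; split=> [u /Ug'[]//|u Uu]; apply: gen_g'; split=> //.
  by apply/eqP/negP => /negP u0; apply: (z u).
pose P n := `[< exists u, [/\ U u, phi i u != 0 & size (phi i u) = n] >].
have exP : exists n, P n.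
  by case: nz => u [Uu u0]; exists (size (phi i u)); apply/asboolP; exists u.
case: (ex_minnP exP) => _ /asboolP[h [Uh h0 <-]] h_min.
exists (h :: g'); split=> [u|u Uu].
  by rewrite in_cons => /predU1P[->//|/Ug'[]].
pose q := phi i u %/ phi i h.
have [|r u_r] := gen_g' (- q *: h + u).
  split; first exact: Ulin.
  rewrite phiP mulNr addrC; apply/eqP/negPn/negP => nz'.
  have: P (size (phi i u - q * phi i h)).
    apply/asboolP; exists (- q *: h + u); split; first exact: Ulin.
      by rewrite phiP mulNr addrC.
    by rewrite phiP mulNr addrC.
  move/h_min; rewrite leqNgt.
  by rewrite {1}(divp_eq (phi i u) (phi i h)) addrC addKr ltn_modp h0.
exists (fun k => if k is j.+1 then r j else q).
by rewrite /= big_ord_recl /= -u_r addrA scaleNr addrN add0r.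
Qed.

End PolyModules.

(** * Algebras that are module-finite over [K[a]] *)

Section ModuleFinite.
Context (K : fieldType) (A : algType K).
Implicit Types (a b c : A) (C I S : set A) (p : {poly K}).

Lemma subalg_genP S : GRing.subalg_closed (mem (subalg_gen S)).
Proof.
split.
- by rewrite inE => B [[B1 _ _] _]; move: B1; rewrite inE.
- move=> k u v; rewrite !inE => Su Sv B BS.
  have [[_ + _] _] := BS => /(_ k u v); rewrite !inE.
  by apply; [apply: Su | apply: Sv].
- move=> u v; rewrite !inE => Su Sv B BS.
  have [[_ _ +] _] := BS => /(_ u v); rewrite !inE.
  by apply; [apply: Su | apply: Sv].
Qed.

Lemma sub_subalg_gen S a : S a -> subalg_gen S a.
Proof. by move=> Sa B [_]; apply. Qed.

Lemma horner_algMXaddC a p (k : K) :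
  horner_alg a (p * 'X + k%:P) = horner_alg a p * a + k%:A.
Proof. by rewrite rmorphD rmorphM /= horner_algC horner_algX. Qed.

Lemma subalg_horner C a p :
  GRing.subalg_closed (mem C) -> C a -> C (horner_alg a p).
Proof.
move=> [C1 Clin Cmul] /mem_set Ca; apply/set_mem.
elim/poly_ind: p => [|p c IHp].
  by rewrite rmorph0 -[0](subrr 1) addrC -scaleN1r Clin.
by rewrite horner_algMXaddC addrC Clin ?Cmul.
Qed.

Lemma horner_algZ a k p : horner_alg a (k *: p) = k *: horner_alg a p.
Proof. by rewrite -mul_polyC rmorphM /= horner_algC -scalerAl mul1r. Qed.

Lemma subalg_gen1P a b :
  subalg_gen [set a] b <-> exists p, b = horner_alg a p.
Proof.
split=> [|[p ->]]; last first.
  apply: (subalg_horner (C := subalg_gen [set a])); first exact: subalg_genP.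
  exact: sub_subalg_gen.
apply: (smallest_sub (X := [set b | exists p, b = horner_alg a p])).
  split=> [|k u v|u v]; rewrite !inE.
  - by exists 1; rewrite rmorph1.
  - move=> [p ->] [q ->]; exists (k *: p + q).
    by rewrite rmorphD /= horner_algZ.
  - by move=> [p ->] [q ->]; exists (p * q); rewrite rmorphM.
by move=> _ ->; exists 'X; rewrite horner_algX.
Qed.

Lemma horner_alg_comm a b p :
  GRing.comm a b -> GRing.comm (horner_alg a p) b.
Proof.
move=> ab; elim/poly_ind: p => [|p c IHp].
  by rewrite rmorph0; apply/commr_sym/commr0.
rewrite horner_algMXaddC.
apply/commr_sym/commrD; first by apply: commrM; apply: commr_sym.
by rewrite /GRing.comm -scalerAl -scalerAr mul1r mulr1.
Qed.

Lemma centralizer_subalg B a :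
  GRing.subalg_closed (mem B) -> GRing.subalg_closed (mem (centralizer B a)).
Proof.
move=> [B1 Blin Bmul]; split=> [|k u v|u v]; rewrite !inE.
- by split; [exact/set_mem | exact: commr1].
- move=> [/mem_set Bu au] [/mem_set Bv av]; split; first by apply/set_mem/Blin.
  by apply: commrD => //; rewrite /GRing.comm -scalerAl -scalerAr au.
- move=> [/mem_set Bu au] [/mem_set Bv av]; split; first by apply/set_mem/Bmul.
  exact: commrM.
Qed.

(** The coefficients are polynomials rather than elements of [K[a]], so that
    this makes sense, and can be transported, without choosing preimages under
    [horner_alg a]. *)
Definition module_finite a C := exists n (m : 'I_n -> A),
  (forall i, C (m i)) /\
  forall c, C c -> exists p : 'I_n -> {poly K},
    c = \sum_(i < n) horner_alg a (p i) * m i.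

Lemma sum_closed C n (f : 'I_n -> A) :
  GRing.zmod_closed (mem C) -> (forall i, C (f i)) -> C (\sum_(i < n) f i).
Proof.
move=> Czmod Cf; apply/set_mem.
elim/big_ind : _ => [|u v Cu Cv|i _]; [by case: Czmod | | exact/mem_set].
have [C0 Csub] := Czmod.
by rewrite -[v]opprK Csub // -[- v]sub0r Csub.
Qed.

Lemma module_finite_fingen a C : GRing.subalg_closed (mem C) -> C a ->
  module_finite a C -> fingen_module (subalg_gen [set a]) C.
Proof.
move=> Calg Ca [n [m [Cm gen]]]; exists n, m; apply/seteqP; split=> c /=.
  move=> /gen[p ->]; exists (fun i => horner_alg a (p i)) => // i.
  by apply/subalg_gen1P; exists (p i).
move=> [r ra ->]; apply: sum_closed.
  exact/GRing.submod_closedB/GRing.subalg_closedZ.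
move=> i; have /subalg_gen1P[p ->] := ra i.
have [_ _ Cmul] := Calg; apply/set_mem/Cmul; apply/mem_set => //.
exact: subalg_horner.
Qed.

Lemma fingen_module_finite a C :
  fingen_module (subalg_gen [set a]) C -> module_finite a C.
Proof.
move=> [n [m ->]]; exists n, m; split=> [i|_ [r ra ->]].
  exists (fun j => (j == i)%:R) => [j|].
    by apply/subalg_gen1P; exists (j == i)%:R; rewrite rmorph_nat.
  rewrite (bigD1 i) //= eqxx mul1r big1 ?addr0 // => j /negPf->.
  by rewrite mul0r.
have /choice[p rp] i : exists p, r i = horner_alg a p by apply/subalg_gen1P.
by exists p; apply: eq_bigr => i _; rewrite rp.
Qed.

Lemma module_finite_fingen_algebra a C : GRing.subalg_closed (mem C) ->
  C a -> module_finite a C -> fingen_algebra C.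
Proof.
move=> Calg Ca [n [m [Cm gen]]]; exists (a :: [seq m i | i <- enum 'I_n]).
apply/seteqP; split=> [c /gen[p ->]|].
  set S := [set` _]; have Galg := subalg_genP S.
  apply: sum_closed; first exact/GRing.submod_closedB/GRing.subalg_closedZ.
  move=> i; have [_ _ Gmul] := Galg; apply/set_mem/Gmul; apply/mem_set.
    apply: (subalg_horner (C := subalg_gen S)) => //.
    by apply: sub_subalg_gen; exact: mem_head.
  by apply: sub_subalg_gen; rewrite /S /= in_cons map_f ?orbT ?mem_enum.
apply: smallest_sub => // b /=.
by rewrite in_cons => /predU1P[->//|/mapP[i _ ->]].
Qed.

(** An increasing chain of [K[a]]-submodules of [C] pulls back to an increasing
    chain of submodules of [{poly K}^n], whose union is finitely generated and
    hence reached at a finite stage. *)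
Lemma module_finite_acc a C (P : set A -> Prop) : module_finite a C ->
  (forall I, P I -> [/\ I `<=` C, GRing.zmod_closed (mem I) &
     forall p u, I u -> I (horner_alg a p * u)]) ->
  ascending_chain_condition P.
Proof.
move=> [n [m [_ gen]]] P_sub I_ PI I_incr.
have I_mono i j : (i <= j)%N -> I_ i `<=` I_ j.
  elim: j => [|j IHj]; first by rewrite leqn0 => /eqP->.
  by rewrite leq_eqVlt => /predU1P[->//|/IHj]/subset_trans; apply.
pose Phi (r : 'rV[{poly K}]_n) := \sum_i horner_alg a (r 0 i) * m i.
have Phi_lin p r r' : Phi (p *: r + r') = horner_alg a p * Phi r + Phi r'.
  rewrite /Phi mulr_sumr -big_split; apply: eq_bigr => i _.
  by rewrite !mxE rmorphD rmorphM mulrDl mulrA.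
have I0 i : I_ i 0 by have [_ [/set_mem]] := P_sub _ (PI i).
have ID i u v : I_ i u -> I_ i v -> I_ i (u + v).
  have [_ /GRing.zmod_closedD[_ +] _] := P_sub _ (PI i).
  by move=> /(_ u v) + Iu Iv; rewrite !inE; apply.
have IM i p u : I_ i u -> I_ i (horner_alg a p * u).
  by have [_ _] := P_sub _ (PI i); apply.
pose U := [set r | exists i, I_ i (Phi r)].
have Phi0 : Phi 0 = 0.
  by rewrite /Phi big1 // => i _; rewrite mxE rmorph0 mul0r.
have [|||g [Ug gen_g]] := @submodule_fingen K 'rV_n 'I_n
    (fun i r => r 0 i) (enum 'I_n) U.
- by move=> i p r r'; rewrite !mxE.
- split; first by rewrite inE; exists 0; rewrite Phi0.
  move=> p r r'; rewrite !inE => -[i Ir] [j Ir']; exists (maxn i j).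
  rewrite Phi_lin; apply: ID.
    by apply: IM; apply: I_mono Ir; exact: leq_maxl.
  by apply: I_mono Ir'; exact: leq_maxr.
- by move=> r _ r0; apply/rowP => i; rewrite r0 ?mxE ?mem_enum.
have [N I_g] : exists N, {in g, forall r, I_ N (Phi r)}.
  elim: g Ug {gen_g} => [|r g IHg] Ug; first by exists 0.
  have [|N IN] := IHg.
    by move=> r' gr'; apply: Ug; rewrite in_cons gr' orbT.
  have [|i Ir] := Ug r; first exact: mem_head.
  exists (maxn i N) => r'; rewrite in_cons => /predU1P[->|/IN].
    by apply: I_mono Ir; exact: leq_maxl.
  by apply: I_mono; exact: leq_maxr.
exists N => k Nk; apply/seteqP; split=> [u Iu|]; last exact: I_mono.
have [IC _ _] := P_sub _ (PI k).
have [p u_p] := gen _ (IC _ Iu).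
have u_Phi : u = Phi (\row_i p i).
  by rewrite u_p; apply: eq_bigr => i _; rewrite mxE.
have [|q r_q] := gen_g (\row_i p i); first by exists k; rewrite -u_Phi.
rewrite u_Phi r_q.
elim/big_ind: _ => [|r r' Ir Ir'|i _]; first by rewrite Phi0.
  by rewrite -[r]scale1r Phi_lin rmorph1 mul1r; exact: ID.
by rewrite -[_ *: _]addr0 Phi_lin Phi0 addr0; apply/IM/I_g/mem_nth.
Qed.

(** As [a] is central in [C], multiplying a right ideal by [K[a]] on the left
    is the same as on the right. *)
Lemma module_finite_noetherian a C :
  GRing.subalg_closed (mem C) -> C a -> (forall c, C c -> GRing.comm a c) ->
  module_finite a C -> noetherian C.
Proof.
move=> Calg Ca C_comm Cfin.
have C_horner p : C (horner_alg a p) by apply: (subalg_horner (C := C)).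
split; apply: (module_finite_acc Cfin) => I [IC Izmod IM]; split=> // p u Iu.
  exact: IM.
by rewrite (horner_alg_comm _ (C_comm _ (IC _ Iu))); apply: IM.
Qed.

End ModuleFinite.

(** * Degree-raising operators *)

Section DegreeRaising.
Context (K : fieldType).
Implicit Types (f g T : polyEnd K) (p q : {poly K}) (C : set (polyEnd K)).

Lemma polyEnd_addE f g p : (f + g) p = f p + g p. Proof. by []. Qed.
Lemma polyEnd_mulE f g p : (f * g) p = f (g p). Proof. by []. Qed.
Lemma polyEnd_scaleE c f p : (c *: f) p = c *: f p. Proof. by []. Qed.

Lemma polyEnd_expand f p : f p = \sum_(i < size p) p`_i *: f 'X^i.
Proof.
rewrite -{1}[p]coefK poly_def linear_sum.
by apply: eq_bigr => i _; rewrite linearZ.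
Qed.

Lemma polyEnd_eqXn f g : (forall n, f 'X^n = g 'X^n) -> f = g.
Proof.
move=> fg; apply: polyEnd_ext => p; rewrite !(polyEnd_expand _ p).
by apply: eq_bigr => i _; rewrite fg.
Qed.

Definition raises_degree d N T :=
  forall n, (N <= n)%N -> size (T 'X^n) = (n + d).+1.

(** [T 'X^(m - d)] has degree [m] once [m >= N + d], so a multiple of it cancels
    the leading term of a polynomial of degree [m], and ['X^(m - d)] is itself
    in the span by induction. *)
Lemma raises_degree_span d N T : (0 < d)%N -> raises_degree d N T ->
  forall q, exists r : 'I_(N + d) -> {poly K},
    q = \sum_i horner_alg T (r i) 'X^i.
Proof.
move=> d_gt0 T_raises.
pose G q := exists r : 'I_(N + d) -> {poly K},
  q = \sum_i horner_alg T (r i) 'X^i.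
have G0 : G 0 by exists (fun=> 0); rewrite big1 // => i _; rewrite rmorph0.
have GD u v : G u -> G v -> G (u + v).
  move=> [r ->] [r' ->]; exists (fun i => r i + r' i).
  by rewrite -big_split; apply: eq_bigr => i _; rewrite rmorphD.
have GM p u : G u -> G (horner_alg T p u).
  move=> [r ->]; exists (fun i => p * r i).
  by rewrite linear_sum; apply: eq_bigr => i _; rewrite rmorphM.
have GZ c u : G u -> G (c *: u).
  by move/(GM c%:P); rewrite horner_algC.
have GX n : (n < N + d)%N -> G 'X^n.
  move=> nNd; exists (fun i => (val i == n)%:R).
  rewrite (bigD1 (Ordinal nNd)) //= eqxx rmorph1 big1 ?addr0 // => i.
  by rewrite -val_eqE /= => /negPf->; rewrite rmorph0.
suff G_size m q : (size q <= m)%N -> G q by move=> q; apply: (G_size (size q)).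
elim/ltn_ind: m q => -[_ q|m IHm q].
  by rewrite leqn0 size_poly_eq0 => /eqP->.
rewrite leq_eqVlt => /predU1P[sz_q|]; last by rewrite ltnS; apply: IHm.
have [mNd|Nd_m] := ltnP m (N + d).
  rewrite -[q]coefK poly_def; elim/big_ind: _ => // i _.
  apply/GZ/GX/(leq_trans (ltn_ord i)); rewrite sz_q.
  exact: mNd.
pose h := T 'X^(m - d).
have dm : (d <= m)%N by apply: leq_trans Nd_m; apply: leq_addl.
have sz_h : size h = m.+1.
  by rewrite /h T_raises ?subnK // leq_subRL // addnC.
have h_nz : lead_coef h != 0 by rewrite lead_coef_eq0 -size_poly_gt0 sz_h.
pose c := lead_coef q / lead_coef h.
rewrite -[q](subrK (c *: h)); apply: GD; last first.
  apply: GZ; rewrite /h -[T]horner_algX; apply: GM.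
  apply: (IHm (m - d).+1); last by rewrite size_polyXn.
  by rewrite ltnS ltn_subrL d_gt0 (leq_trans d_gt0).
apply: (IHm m) => //; apply/leq_sizeP => j.
rewrite leq_eqVlt => /predU1P[<-|mj].
  have h_m : h`_m = lead_coef h by rewrite lead_coefE sz_h.
  by rewrite coefB coefZ h_m divfK // lead_coefE sz_q subrr.
by rewrite coefB coefZ !nth_default ?mulr0 ?subr0 ?sz_q ?sz_h.
Qed.

(** An operator [c] commuting with [T] is determined by the values [c 'X^i],
    [i < N + d], which expand over the same generators; the coefficient matrices
    obtained in this way form a submodule of a finite free module. *)
Lemma raises_degree_module_finite d N T C : (0 < d)%N -> raises_degree d N T ->
  GRing.submod_closed (mem C) -> (forall c, C c -> C (T * c)) ->
  (forall c, C c -> GRing.comm T c) -> module_finite T C.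
Proof.
move=> d_gt0 T_raises [C0 Clin] CT C_comm.
have {}C0 := set_mem C0.
have {}Clin k u v : C u -> C v -> C (k *: u + v).
  by move=> Cu Cv; have := Clin k u v; rewrite !inE; apply.
have span := raises_degree_span d_gt0 T_raises.
set s := (N + d)%N in span.
have C_horner p c : C c -> C (horner_alg T p * c).
  elim/poly_ind: p c => [|p k IHp] c Cc; first by rewrite rmorph0 mul0r.
  rewrite horner_algMXaddC mulrDl addrC -mulrA.
  by rewrite -scalerAl mul1r; apply: Clin => //; apply/IHp/CT.
have C_eq c c' : C c -> C c' -> (forall i : 'I_s, c 'X^i = c' 'X^i) -> c = c'.
  move=> Cc Cc' cc'; apply: polyEnd_ext => q; have [r ->] := span q.
  rewrite !linear_sum; apply: eq_bigr => i _.
  have H b : C b -> b (horner_alg T (r i) 'X^i) = horner_alg T (r i) (b 'X^i).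
    by move=> Cb; rewrite -!polyEnd_mulE (horner_alg_comm _ (C_comm _ Cb)).
  by rewrite !H // cc'.
pose rep (r : 'M[{poly K}]_s) (c : polyEnd K) :=
  forall i : 'I_s, c 'X^i = \sum_j horner_alg T (r i j) 'X^j.
pose U := [set r | exists2 c, C c & rep r c].
have rep_lin p r r' c c' : rep r c -> rep r' c' ->
    rep (p *: r + r') (horner_alg T p * c + c').
  move=> rc rc' i.
  rewrite polyEnd_addE polyEnd_mulE rc rc' linear_sum -big_split.
  by apply: eq_bigr => j _; rewrite !mxE rmorphD rmorphM.
have rep0 : rep 0 0 by move=> i; rewrite big1 // => j _; rewrite mxE rmorph0.
have [|||g [Ug gen_g]] := @submodule_fingen K 'M_s ('I_s * 'I_s)%type
    (fun ij r => r ij.1 ij.2) (enum {: 'I_s * 'I_s}) U.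
- by move=> ij p r r'; rewrite !mxE.
- split; first by rewrite inE; exists 0.
  move=> p r r'; rewrite !inE => -[c Cc rc] [c' Cc' rc'].
  exists (horner_alg T p * c + c'); last exact: rep_lin.
  by rewrite -[_ * c]scale1r; apply: Clin => //; apply: C_horner.
- by move=> r _ r0; apply/matrixP => i j; rewrite (r0 (i, j)) ?mxE ?mem_enum.
have /choice[m m_g] (i : 'I_(size g)) : exists c, C c /\ rep g`_i c.
  by have [c] := Ug _ (mem_nth 0 (ltn_ord i)); exists c.
exists (size g), m; split=> [i|c Cc]; first by have [] := m_g i.
have /choice[r rc] (i : 'I_s) : exists r : 'I_s -> {poly K},
    c 'X^i = \sum_j horner_alg T (r j) 'X^j by apply: span.
have [|p r_p] := gen_g (\matrix_(i, j) r i j).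
  by exists c => // i; rewrite rc; apply: eq_bigr => j _; rewrite mxE.
exists (fun i => p i); apply: C_eq => //.
  elim/big_ind: _ => [|u v Cu Cv|i _] //.
    by rewrite -[u]scale1r; apply: Clin.
  by apply: C_horner; have [] := m_g i.
suff: rep (\sum_(i < size g) p i *: g`_i)
          (\sum_(i < size g) horner_alg T (p i) * m i).
  by move=> mp i; rewrite mp -r_p rc; apply: eq_bigr => j _; rewrite mxE.
elim/big_rec2: _ => // i r' c' _ rc'; apply: rep_lin => //.
by have [] := m_g i.
Qed.

End DegreeRaising.

(** * The matrix of an operator in the basis of divided powers *)

Section DividedPowers.
Context (K : fieldType) (char0 : [pchar K] =i pred0).
Implicit Types (f g : polyEnd K) (p q : {poly K}).

Lemma natr_neq0 n : (n.+1%:R : K) != 0.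
Proof. by rewrite (proj1 (pcharf0P K) char0). Qed.

Lemma factr_neq0 n : (n`!%:R : K) != 0.
Proof. by rewrite (proj1 (pcharf0P K) char0) -lt0n fact_gt0. Qed.

(** The entry in row [i], column [j] of the matrix of [f] in the basis
    ['X^n / n!], in which [op_d] and [op_int] become pure shifts and [op_H]
    becomes the diagonal matrix of [n + 1]. *)
Definition ent f i j : K := (f 'X^j)`_i * i`!%:R / j`!%:R.

Lemma entE f i j : (f 'X^j)`_i = ent f i j * j`!%:R / i`!%:R.
Proof. by rewrite /ent divfK ?factr_neq0 // mulfK ?factr_neq0. Qed.

Lemma ent_eq0 f i j : (ent f i j == 0) = ((f 'X^j)`_i == 0).
Proof.
by rewrite /ent !mulf_eq0 invr_eq0 !(negPf (factr_neq0 _)) !orbF.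
Qed.

Lemma ent_inj f g : (forall i j, ent f i j = ent g i j) -> f = g.
Proof.
by move=> fg; apply: polyEnd_eqXn => j; apply/polyP => i; rewrite !entE fg.
Qed.

Lemma entP c f g i j : ent (c *: f + g) i j = c * ent f i j + ent g i j.
Proof.
by rewrite /ent polyEnd_addE polyEnd_scaleE coefD coefZ !mulrDl !mulrA.
Qed.

Lemma entB f g i j : ent (f - g) i j = ent f i j - ent g i j.
Proof. by rewrite addrC -scaleN1r entP mulN1r addrC. Qed.

Lemma ent0 i j : ent 0 i j = 0.
Proof. by rewrite /ent coef0 !mul0r. Qed.

Lemma ent1 i j : ent 1 i j = (i == j)%:R.
Proof.
rewrite /ent coefXn; case: eqP => [->|_]; last by rewrite !mul0r.
by rewrite mul1r divff ?factr_neq0.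
Qed.

Lemma ent_d f i j : ent (op_d K * f) i j = ent f i.+1 j.
Proof.
by rewrite /ent polyEnd_mulE coef_deriv mulrnAl -mulrnAr -mulrnA mulnC -factS.
Qed.

Lemma ent_int0 f j : ent (op_int K * f) 0 j = 0.
Proof. by rewrite /ent polyEnd_mulE coef_int_poly !mul0r. Qed.

Lemma ent_intS f i j : ent (op_int K * f) i.+1 j = ent f i j.
Proof.
by rewrite /ent polyEnd_mulE coef_int_poly factS natrM mulrA divfK ?natr_neq0.
Qed.

Lemma ent_x0 f j : ent (op_x K * f) 0 j = 0.
Proof. by rewrite /ent polyEnd_mulE coefXM !mul0r. Qed.

Lemma ent_xS f i j : ent (op_x K * f) i.+1 j = i.+1%:R * ent f i j.
Proof.
rewrite /ent polyEnd_mulE coefXM factS natrM !mulrA.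
by rewrite [_ * i.+1%:R]mulrC.
Qed.

Lemma ent_dX n f i j : ent (op_d K ^+ n * f) i j = ent f (n + i) j.
Proof.
elim: n i => [|n IHn] i; first by rewrite expr0 mul1r.
by rewrite exprS -mulrA ent_d IHn addnS.
Qed.

Lemma ent_intX n f i j : ent (op_int K ^+ n * f) i j =
  if (n <= i)%N then ent f (i - n) j else 0.
Proof.
elim: n i => [|n IHn] i; first by rewrite expr0 mul1r subn0.
rewrite exprS -mulrA; case: i => [|i]; first by rewrite ent_int0.
by rewrite ent_intS IHn.
Qed.

Lemma ent_e i j k l : ent (op_e K i j) k l = ((k == i) && (l == j))%:R.
Proof.
rewrite /op_e entB exprSr -mulrA -[op_d K ^+ j]mulr1 -[op_d K ^+ j.+1]mulr1.
rewrite !ent_intX; have [ik|ki] := leqP i k; last first.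
  by rewrite subr0 (ltn_eqF ki).
rewrite ent_dX ent1; have [->|ki] := eqVneq k i.
  by rewrite subnn addn0 ent_int0 subr0 eq_sym.
have {ik ki} -> : (k - i = (k - i).-1.+1)%N.
  by rewrite prednK // subn_gt0 ltn_neqAle eq_sym ki.
by rewrite ent_intS ent_dX ent1 addnS addSn subrr.
Qed.

Lemma op_eE i j p : op_e K i j p = (p`_j * j`!%:R / i`!%:R) *: 'X^i.
Proof.
apply/polyP => k; rewrite polyEnd_expand coef_sum coefZ coefXn.
under eq_bigr => n _ do rewrite coefZ entE ent_e.
have [jp|pj] := ltnP j (size p); last first.
  rewrite big1 ?nth_default ?mul0r // => n _.
  by rewrite (ltn_eqF (leq_trans (ltn_ord n) pj)) andbF !mul0r mulr0.
rewrite (bigD1 (Ordinal jp)) //= eqxx andbT big1 ?addr0 => [|n].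
  case: eqP => [->|_]; first by rewrite mulr1 mul1r !mulrA.
  by rewrite !mul0r !mulr0.
by rewrite -val_eqE /= => /negPf->; rewrite andbF !mul0r mulr0.
Qed.

Lemma op_H_Xn n : op_H K 'X^n = n.+1%:R *: 'X^n.
Proof. by rewrite polyEnd_mulE /= /mulx_poly -exprS derivXn scaler_nat. Qed.

Lemma ent_horner_H p i j :
  ent (horner_alg (op_H K) p) i j = (i == j)%:R * p.[j.+1%:R].
Proof.
suff H_Xn : horner_alg (op_H K) p 'X^j = p.[j.+1%:R] *: 'X^j.
  by rewrite /ent H_Xn coefZ [RHS]mulrC -ent1 /ent !mulrA.
elim/poly_ind: p => [|p c IHp]; first by rewrite rmorph0 horner0 scale0r.
rewrite horner_algMXaddC hornerMXaddC.
rewrite polyEnd_addE polyEnd_mulE op_H_Xn polyEnd_scaleE linearZ /= IHp.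
rewrite scalerDl scalerA.
by rewrite [_ * p.[_]]mulrC.
Qed.

(** * Adjoints *)

(** The symmetric form for which the polynomials ['X^n / n!] are orthonormal, so
    that adjoints are transposes of the matrices [ent]. *)
Definition pair p q : K := \sum_(i < size p) p`_i * q`_i * i`!%:R ^+ 2.

Lemma pairE n p q : (size p <= n)%N ->
  pair p q = \sum_(i < n) p`_i * q`_i * i`!%:R ^+ 2.
Proof.
move=> pn; rewrite /pair.
rewrite (big_ord_widen _ (fun i => p`_i * q`_i * i`!%:R ^+ 2) pn) big_mkcond /=.
by apply: eq_bigr => i _; case: ltnP => // pi; rewrite nth_default ?mul0r.
Qed.

Lemma pairC p q : pair p q = pair q p.
Proof.
rewrite (pairE _ (leq_maxl (size p) (size q))).
rewrite (pairE _ (leq_maxr (size p) (size q))).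
by apply: eq_bigr => i _; rewrite [p`_i * _]mulrC.
Qed.

Lemma pairP c p p' q : pair q (c *: p + p') = c * pair q p + pair q p'.
Proof.
rewrite /pair mulr_sumr -big_split; apply: eq_bigr => i _.
by rewrite coefD coefZ mulrDr mulrDl !mulrA [c * _]mulrC.
Qed.

Lemma pairXn i q : pair 'X^i q = q`_i * i`!%:R ^+ 2.
Proof.
rewrite /pair size_polyXn big_ord_recr /= coefXn eqxx mul1r.
rewrite big1 ?add0r // => k _.
by rewrite coefXn (ltn_eqF (ltn_ord k)) !mul0r.
Qed.

Definition adjoint f g := forall p q, pair (f p) q = pair p (g q).

Lemma adjoint_sym f g : adjoint f g -> adjoint g f.
Proof. by move=> fg p q; rewrite pairC -fg pairC. Qed.

Lemma adjoint_uniq f g h : adjoint f h -> adjoint g h -> f = g.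
Proof.
move=> fh gh; apply: polyEnd_ext => p; apply/polyP => i.
have /eqP := pairXn i (f p); rewrite pairC fh -gh pairC pairXn.
by rewrite (inj_eq (mulIf _)) ?expf_neq0 ?factr_neq0 // => /eqP.
Qed.

Lemma adjoint_ent f g i j : adjoint f g -> ent g j i = ent f i j.
Proof.
move=> fg; have := fg 'X^j 'X^i; rewrite pairC !pairXn => fgE.
by apply/eqP; rewrite /ent eqr_div ?factr_neq0 // -!mulrA -!expr2 fgE.
Qed.

Lemma adjoint1 : adjoint 1 1. Proof. by []. Qed.

Lemma adjointP c f g f' g' :
  adjoint f f' -> adjoint g g' -> adjoint (c *: f + g) (c *: f' + g').
Proof.
move=> ff gg p q; rewrite !polyEnd_addE !polyEnd_scaleE pairC !pairP.
by rewrite ![pair q _]pairC ff gg.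
Qed.

Lemma adjoint0 : adjoint 0 0.
Proof.
move=> p q; rewrite pairC /pair !big1 // => i _;
  by rewrite coef0 mulr0 mul0r.
Qed.

Lemma adjointM f g f' g' :
  adjoint f f' -> adjoint g g' -> adjoint (f * g) (g' * f').
Proof. by move=> ff gg p q; rewrite !polyEnd_mulE ff gg. Qed.

Lemma adjoint_horner f g p :
  adjoint f g -> adjoint (horner_alg f p) (horner_alg g p).
Proof.
move=> fg; elim/poly_ind: p => [|p c IHp].
  by rewrite !rmorph0; apply: adjoint0.
rewrite !horner_algMXaddC.
(* adjoints reverse products, so [p(g)] has to be moved past [g] *)
rewrite (horner_alg_comm p (erefl (g * g))) ![_ + c *: 1]addrC.
by apply: adjointP; [exact: adjoint1 | exact: adjointM].
Qed.

Lemma adjoint_int : adjoint (op_int K) (op_d K).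
Proof.
move=> p q; have sz_int : (size (op_int K p) <= (size p).+1)%N.
  apply/leq_sizeP => -[//|i] pi.
  by rewrite coef_int_poly nth_default ?mul0r.
rewrite (pairE _ sz_int) big_ord_recl /= coef_int_poly !mul0r add0r.
apply: eq_bigr => i _; rewrite /bump add1n coef_int_poly coef_deriv factS natrM.
rewrite -[q`_i.+1 *+ _]mulr_natr !mulrA; congr (_ * _).
by rewrite [LHS]mulrAC; congr (_ * _ * _); rewrite mulrAC divfK ?natr_neq0.
Qed.

(** Since [op_x = op_int * op_H], its adjoint is [op_H * op_d]. *)
Lemma adjoint_x : adjoint (op_x K) (op_d K * op_x K * op_d K).
Proof.
move=> p q; have sz_x : (size (op_x K p) <= (size p).+1)%N.
  by apply/leq_sizeP => -[//|i] pi; rewrite coefXM nth_default.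
rewrite (pairE _ sz_x) big_ord_recl /= coefXM !mul0r add0r.
apply: eq_bigr => i _; rewrite /bump add1n coefXM !coef_deriv coefXM coef_deriv.
rewrite factS natrM.
by rewrite /= exprMn -mulrnA -[q`__ *+ _]mulr_natr natrM !mulrA.
Qed.

Lemma I1_adjoint f : I1 K f -> exists g, adjoint f g.
Proof.
apply: (smallest_sub (X := [set f | exists g, adjoint f g])).
  split=> [|k u v|u v]; rewrite !inE.
  - by exists 1; apply: adjoint1.
  - by move=> [u' uu] [v' vv]; exists (k *: u' + v'); apply: adjointP.
  - by move=> [u' uu] [v' vv]; exists (v' * u'); apply: adjointM.
move=> _ /= [[->|->]|->]; eexists.
- exact: adjoint_x.
- exact/adjoint_sym/adjoint_int.
- exact: adjoint_int.
Qed.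

End DividedPowers.

(** * Elements of [I1] have eventually polynomial diagonals *)

Section EventuallyPolynomial.
Context (K : fieldType) (char0 : [pchar K] =i pred0).
Implicit Types (f g : polyEnd K) (p q : {poly K}) (alpha : int -> {poly K}).

(** In characteristic zero the natural numbers are distinct in [K], so only
    finitely many of them are roots. *)
Lemma nat_roots_bounded p : p != 0 ->
  exists M, forall n, (M <= n)%N -> p.[n%:R] != 0.
Proof.
have [m] := ubnP (size p); elim: m p => // m IHm p; rewrite ltnS => sz_p p0.
have [[k pk]|/forallNP no_root] := pselect (exists k, root p k%:R); last first.
  by exists 0%N => n _; apply/negP => /no_root.
have /factor_theorem[q p_q] := pk.
have q0 : q != 0 by apply: contraNneq p0 => q0; rewrite p_q q0 mul0r.
have [|//|M qM] := IHm q.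
  by move: sz_p; rewrite p_q size_Mmonic ?monicXsubC // size_XsubC addn2.
exists (maxn M k.+1) => n; rewrite geq_max => /andP[Mn kn].
rewrite p_q hornerM mulf_neq0 ?qM // hornerXsubC -natrB; last exact: ltnW.
by move: kn; rewrite -subn_gt0; case: (n - k)%N => // j _; apply: natr_neq0.
Qed.

Definition banded D f :=
  forall i j, ent f i j != 0 -> (i <= j + D)%N /\ (j <= i + D)%N.

(** The diagonals are indexed by row minus column, and their polynomials are
    evaluated at the row index. *)
Definition poly_diag N alpha f := forall i j, (N <= i)%N -> (N <= j)%N ->
  ent f i j = (alpha (i%:Z - j%:Z)).[i%:R].

Definition evpoly f :=
  exists D N alpha, banded D f /\ poly_diag N alpha f.

Lemma subSz (i : nat) (z : int) : i.+1%:Z - z = i%:Z - z + 1.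
Proof. by rewrite -addn1 PoszD addrAC. Qed.

Lemma evpolyP k f g : evpoly f -> evpoly g -> evpoly (k *: f + g).
Proof.
move=> [D [N [al [fD fal]]]] [D' [N' [al' [gD gal]]]].
exists (maxn D D'), (maxn N N'), (fun i => k *: al i + al' i); split=> i j.
  rewrite entP => nz.
  have [f0|/fD[ij ji]] := eqVneq (ent f i j) 0; last first.
    split; [apply: leq_trans ij _|apply: leq_trans ji _];
      by rewrite leq_add2l leq_maxl.
  move: nz; rewrite f0 mulr0 add0r => /gD[ij ji].
  split; [apply: leq_trans ij _|apply: leq_trans ji _];
    by rewrite leq_add2l leq_maxr.
rewrite !geq_max => /andP[Ni Ni'] /andP[Nj Nj'].
by rewrite entP fal // gal // hornerD hornerZ.
Qed.

Lemma evpoly1 : evpoly 1.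
Proof.
exists 0%N, 0%N, (fun k => (k == 0)%:R); split=> i j.
  rewrite (ent1 char0) !addn0.
  by case: (i =P j) => [->|_]; rewrite ?eqxx ?leqnn.
move=> _ _; rewrite (ent1 char0) subr_eq0 eqz_nat.
by case: eqP => _; rewrite ?hornerC ?horner0.
Qed.

Lemma evpoly_d f : evpoly f -> evpoly (op_d K * f).
Proof.
move=> [D [N [al [fD fal]]]].
exists D.+1, N, (fun k => al (k + 1) \Po ('X + 1%:P)); split=> i j.
  rewrite ent_d => /fD[ij ji]; rewrite !addnS; split; last by rewrite -addSn.
  by apply/leqW/ltnW.
move=> Ni Nj; rewrite ent_d fal ?leqW // horner_comp hornerD hornerX hornerC.
by rewrite subSz natr1.
Qed.

Lemma evpoly_int f : evpoly f -> evpoly (op_int K * f).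
Proof.
move=> [D [N [al [fD fal]]]].
exists D.+1, N.+1, (fun k => al (k - 1) \Po ('X - 1%:P)); split=> -[|i] j.
- by rewrite ent_int0 eqxx.
- rewrite (ent_intS char0) => /fD[ij ji]; rewrite !addnS; split => //.
  by rewrite addSn; apply/leqW/leqW.
- by [].
- move=> Ni /ltnW Nj; rewrite (ent_intS char0) fal // horner_comp hornerXsubC.
  by rewrite subSz addrK -natr1 addrK.
Qed.

Lemma evpoly_x f : evpoly f -> evpoly (op_x K * f).
Proof.
move=> [D [N [al [fD fal]]]].
exists D.+1, N.+1, (fun k => 'X * (al (k - 1) \Po ('X - 1%:P))).
split=> -[|i] j.
- by rewrite ent_x0 eqxx.
- rewrite ent_xS mulf_eq0 negb_or => /andP[_ /fD[ij ji]].
  rewrite !addnS; split => //.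
  by rewrite addSn; apply/leqW/leqW.
- by [].
- move=> Ni /ltnW Nj; rewrite ent_xS fal // hornerM hornerX.
  rewrite horner_comp hornerXsubC.
  by rewrite subSz addrK -natr1 addrK.
Qed.

(** Multiplication by a generator on the left only shifts rows and, for [op_x],
    multiplies them by their index.  So the elements that preserve [evpoly] by
    left multiplication form a subalgebra containing the generators. *)
Lemma I1_evpoly f : I1 K f -> evpoly f.
Proof.
move=> fI1; rewrite -[f]mulr1.
(* closure under left multiplication suffices, as the unit is in the class *)
suff: [set b | forall g, evpoly g -> evpoly (b * g)] f by apply; apply: evpoly1.
move: f fI1; apply: smallest_sub.
  split=> [|k u v|u v]; rewrite !inE.
  - by move=> g; rewrite mul1r.
  - by move=> Hu Hv g g_ev; rewrite mulrDl -scalerAl; apply: evpolyP; auto.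
  - by move=> Hu Hv g g_ev; rewrite -mulrA; auto.
move=> _ /= [[->|->]|->] g.
- exact: evpoly_x.
- exact: evpoly_d.
- exact: evpoly_int.
Qed.

(** In the transpose the old row index is the new column index, which is the new
    row index minus the index of the diagonal. *)
Lemma poly_diag_adjoint N alpha f g : adjoint f g -> poly_diag N alpha f ->
  poly_diag N (fun k => alpha (- k) \Po ('X - k%:~R%:P)) g.
Proof.
move=> fg f_al i j Ni Nj; rewrite (adjoint_ent char0 _ _ fg) f_al //.
rewrite horner_comp hornerXsubC opprB rmorphB /=.
by rewrite opprB [_ + (_ - _)]addrC subrK.
Qed.

(** Take the lowest diagonal with a nonzero polynomial; bandedness says that
    there is one.  Beyond the roots of that polynomial, its entries are the
    lowest nonzero ones of their columns. *)
Lemma poly_diag_raises D N alpha k f : banded D f -> poly_diag N alpha f ->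
  (0 < k)%N -> alpha k != 0 ->
  exists d M, (0 < d)%N /\ raises_degree d M f.
Proof.
move=> f_band f_al k_gt0 al_k.
have alE i j n : (N <= i)%N -> (n = i + j)%N -> ent f n i = (alpha j).[n%:R].
  move=> Ni ->; rewrite f_al ?(leq_trans Ni) ?leq_addr //.
  by rewrite PoszD addrC addKr.
pose P j := (0 < j)%N && (alpha j != 0).
have P_bound j : P j -> (j <= D)%N.
  move=> /andP[_ /nat_roots_bounded[M jM]].
  have /f_band[] : ent f (N + M + j) (N + M) != 0.
    by rewrite (alE _ j) ?leq_addr // jM // -addnA addnCA leq_addr.
  by rewrite leq_add2l.
have exP : exists j, P j by exists k; rewrite /P k_gt0.
case: (ex_maxnP exP P_bound) => d /andP[d_gt0 /nat_roots_bounded[M dM]] d_max.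
exists d, (N + M)%N; split=> // n NMn.
have Nn : (N <= n)%N by apply: leq_trans NMn; apply: leq_addr.
have Mn : (M <= n)%N by apply: leq_trans NMn; apply: leq_addl.
apply/anti_leq/andP; split.
  apply/leq_sizeP => i di; apply/eqP; rewrite -(ent_eq0 char0).
  have ni : (n <= i)%N by apply: leq_trans (ltnW di); apply: leq_addr.
  rewrite (alE n (i - n)%N) ?subnKC //.
  have [->|al_i] := eqVneq (alpha (i - n)%N) 0; first by rewrite horner0.
  have: P (i - n)%N.
    by rewrite /P al_i subn_gt0 andbT (leq_trans _ di) // ltnS leq_addr.
  by move/d_max; rewrite leqNgt ltn_subRL di.
rewrite ltnNge; apply/negP => /leq_sizeP/(_ (n + d)%N (leqnn _))/eqP.
rewrite -(ent_eq0 char0) (alE n d) //; apply/negP/dM.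
by rewrite (leq_trans Mn) ?leq_addr.
Qed.

Lemma lin_span_closed (A : algType K) (S : set A) :
  GRing.submod_closed (mem (lin_span S)).
Proof.
split=> [|k u v]; first by rewrite inE => B [[B0 _] _]; move: B0; rewrite inE.
rewrite !inE => Su Sv B BS; have [[_ +] _] := BS => /(_ k u v); rewrite !inE.
by apply; [apply: Su | apply: Sv].
Qed.

Lemma finite_entries_idealF M f :
  (forall i j, ent f i j != 0 -> (i < M)%N /\ (j < M)%N) -> idealF K f.
Proof.
move=> fM.
have -> : f = \sum_(i < M) \sum_(j < M) ent f i j *: op_e K i j.
  apply: (ent_inj char0) => k l.
  have ent_sum n (F : 'I_n -> polyEnd K) :
      ent (\sum_(i < n) F i) k l = \sum_(i < n) ent (F i) k l.
    elim/big_rec2: _ => [|i x y _ <-]; first exact: ent0.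
    by rewrite -[F i]scale1r entP mul1r scale1r.
  rewrite ent_sum; under eq_bigr => i _.
    rewrite ent_sum; under eq_bigr => j _.
      rewrite -[_ *: _]addr0 entP ent0 addr0 (ent_e char0); over.
    over.
  have [z|nz] := eqVneq (ent f k l) 0.
    rewrite z big1 // => i _; rewrite big1 // => j _.
    by case: eqP => [<-|_]; case: eqP => [<-|_]; rewrite ?z ?mul0r ?mulr0.
  have [kM lM] := fM _ _ nz.
  rewrite (bigD1 (Ordinal kM)) //= (bigD1 (Ordinal lM)) //= !eqxx mulr1.
  rewrite !big1 ?addr0 // => [i ik|j jl].
    rewrite big1 // => j _.
    by move: ik; rewrite -val_eqE eq_sym /= => /negPf->; rewrite mulr0.
  by move: jl; rewrite -val_eqE eq_sym /= => /negPf->; rewrite ?andbF mulr0.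
have [F0 Flin] :=
  lin_span_closed [set op_e K ij.1 ij.2 | ij in [set: nat * nat]].
apply/set_mem; elim/big_ind: _ => // [u v Fu Fv|i _].
  by rewrite -[u]scale1r Flin.
elim/big_ind: _ => // [u v Fu Fv|j _]; first by rewrite -[u]scale1r Flin.
rewrite -[_ *: _]addr0 Flin //; apply/mem_set => B [_]; apply.
by exists (val i, val j).
Qed.

(** The eigenvalue of [op_H] on ['X^n] is [n + 1], so the polynomial of the main
    diagonal has to be shifted by one to give the component in [K[H]].  After
    subtracting that component finitely many entries remain. *)
Lemma diagonal_sum_HF D N alpha f : banded D f -> poly_diag N alpha f ->
  (forall k, k != 0 -> alpha k = 0) ->
  sum_set (subalg_gen [set op_H K]) (idealF K) f.
Proof.
move=> f_band f_al al0.
pose h := horner_alg (op_H K) (alpha 0 \Po ('X - 1%:P)).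
exists h; first by apply/subalg_gen1P; exists (alpha 0 \Po ('X - 1%:P)).
exists (f - h); last by rewrite addrC subrK.
have entB0 i j : (N <= i)%N -> (N <= j)%N -> ent (f - h) i j = 0.
  move=> Ni Nj; rewrite entB (ent_horner_H char0) horner_comp hornerXsubC.
  rewrite -natr1 addrK f_al //; have [->|ij] := eqVneq i j.
    by rewrite subrr mul1r subrr.
  by rewrite al0 ?horner0 ?mul0r ?subr0 // subr_eq0 eqz_nat.
have hb i j : (i <= j + D)%N && (j <= i + D)%N = false -> ent (f - h) i j = 0.
  move=> ij; rewrite entB (ent_horner_H char0); case: eqP ij => [->|_].
    by rewrite leq_addr.
  move=> ij; rewrite mul0r subr0; apply/eqP/negPn/negP => /f_band[].
  by move: ij => /negbT/nandP[/negPf->|/negPf->].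
apply: (finite_entries_idealF (M := (N + D)%N)) => i j nz.
have [iM|Mi] := ltnP i (N + D)%N.
  split=> //; rewrite ltnNge; apply/negP => Mj; case/eqP: nz.
  have [Ni|iN] := leqP N i.
    by apply: entB0 => //; apply: leq_trans Mj; apply: leq_addr.
  apply: hb; rewrite [X in _ && X]leqNgt (leq_trans _ Mj) ?andbF //.
  by rewrite ltn_add2r.
case/eqP: nz; have [Nj|jN] := leqP N j.
  by apply: entB0 => //; apply: leq_trans Mi; apply: leq_addr.
by apply: hb; rewrite leqNgt (leq_trans _ Mi) ?ltn_add2r.
Qed.

(** * Module-finiteness of centralizers *)

(** Taking adjoints exchanges left and right multiplication by [a]; the
    hypothesis that [C] commutes with [a] makes this harmless. *)
Lemma module_finite_adjoint a T (C : set (polyEnd K)) : adjoint a T ->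
  (forall c, C c -> GRing.comm a c) ->
  (forall c, C c -> exists g, adjoint c g) ->
  module_finite T [set g | exists2 c, C c & adjoint c g] ->
  module_finite a C.
Proof.
move=> aT C_comm C_adj [n [m [Cm gen]]].
have /choice[c cm] i : exists c, C c /\ adjoint c (m i).
  by have [c] := Cm i; exists c.
exists n, c; split=> [i|b Cb]; first by have [] := cm i.
have [g bg] := C_adj _ Cb; have [|p g_p] := gen g; first by exists b.
exists p; apply: (adjoint_uniq char0 bg); rewrite g_p.
elim/big_rec2: _ => [|i u v _ uv]; first exact: adjoint0.
have [Cc cmi] := cm i.
rewrite -[_ * m i]scale1r -[_ * c i]scale1r; apply: adjointP => //.
rewrite (horner_alg_comm _ (C_comm _ Cc)); apply: adjointM => //.
exact: adjoint_horner.
Qed.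

Lemma centralizer_module_finite a : I1 K a ->
  ~ sum_set (subalg_gen [set op_H K]) (idealF K) a ->
  module_finite a (centralizer (I1 K) a).
Proof.
move=> aI1 aHF; set C := centralizer _ _.
have [C1 Clin CM] : GRing.subalg_closed (mem C).
  exact/centralizer_subalg/subalg_genP.
have [g ag] := I1_adjoint char0 aI1.
have [D [N [al [a_band a_al]]]] := I1_evpoly aI1.
have /existsNP[k /not_implyP[k0 /eqP al_k]] : ~ forall k, k != 0 -> al k = 0.
  by move=> al0; apply/aHF/(diagonal_sum_HF a_band a_al).
case: k k0 al_k => [[//|k] _ al_k|k _ al_k].
  (* a diagonal below the main one: [a] itself raises degrees *)
  have [d [M [d_gt0 a_raises]]] := poly_diag_raises a_band a_al (ltn0Sn k) al_k.
  apply: (raises_degree_module_finite d_gt0 a_raises) => [|c Cc|c [] //].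
    by apply: GRing.subalg_closedZ.
  by apply/set_mem/CM; apply/mem_set => //; split => //; apply: commr_refl.
(* a diagonal above the main one: the adjoint of [a] raises degrees *)
have g_al := poly_diag_adjoint ag a_al.
have g_band : banded D g.
  by move=> i j; rewrite (adjoint_ent char0 _ _ ag) => /a_band[].
have [|d [M [d_gt0 g_raises]]] := poly_diag_raises g_band g_al (ltn0Sn k).
  by rewrite -size_poly_eq0 size_comp_poly2 ?size_XsubC // size_poly_eq0.
apply: (module_finite_adjoint ag) => [c [] //|c [cI1 _]|].
  exact: I1_adjoint.
apply: (raises_degree_module_finite d_gt0 g_raises).
- split=> [|r u v]; rewrite !inE.
    exists 0; last exact: adjoint0.
    have [/set_mem C0 _] : GRing.submod_closed (mem C).
      exact: GRing.subalg_closedZ.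
    exact: C0.
  move=> [u' Cu uu] [v' Cv vv]; exists (r *: u' + v'); last exact: adjointP.
  by apply/set_mem/Clin; apply/mem_set.
- move=> h [c Cc ch]; exists (c * a); last exact: adjointM.
  by apply/set_mem/CM; apply/mem_set => //; split => //; apply: commr_refl.
- move=> h [c [_ ac] ch]; apply: (adjoint_uniq char0 (h := c * a)).
    by apply: adjoint_sym; apply: adjointM.
  by rewrite -ac; apply: adjoint_sym; apply: adjointM.
Qed.

End EventuallyPolynomial.

(** * Diagonal matrix units *)

Section NotNoetherian.
Context (K : fieldType) (char0 : [pchar K] =i pred0).
Implicit Types (a f g : polyEnd K).

Lemma op_e_diagE n (p : {poly K}) : op_e K n n p = p`_n *: 'X^n.
Proof. by rewrite (op_eE char0) mulfK ?factr_neq0. Qed.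

Lemma op_e_diag_mul m n : op_e K m m * op_e K n n = (m == n)%:R *: op_e K n n.
Proof.
apply: polyEnd_ext => p; rewrite polyEnd_mulE polyEnd_scaleE !op_e_diagE.
rewrite coefZ coefXn; case: eqP => [->|_]; first by rewrite mulr1 scale1r.
by rewrite mulr0 !scale0r.
Qed.

Lemma op_e_diag_neq0 n : op_e K n n <> 0.
Proof.
move=> e0; have := ent_e char0 n n n n; rewrite e0 ent0 eqxx /=.
by move/eqP; rewrite eq_sym oner_eq0.
Qed.

Lemma op_e_I1 i j : I1 K (op_e K i j).
Proof.
have [I1_1 I1_lin I1_mul] := subalg_genP [set op_x K; op_d K; op_int K].
have pow f n : I1 K f -> f ^+ n \in mem (I1 K).
  move/mem_set => If; elim: n => [|n IHn]; first by rewrite expr0.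
  by rewrite exprS I1_mul.
have Id : I1 K (op_d K) by apply: sub_subalg_gen; left; right.
have Iint : I1 K (op_int K) by apply: sub_subalg_gen; right.
apply/set_mem; rewrite /op_e addrC -scaleN1r.
by apply: I1_lin; apply: I1_mul; apply: pow.
Qed.

Lemma comm_H_diag f n :
  subalg_gen [set op_H K] f -> GRing.comm f (op_e K n n).
Proof.
apply: (smallest_sub (X := [set f | GRing.comm f (op_e K n n)])).
  split=> [|k u v|u v]; rewrite !inE.
  - exact/commr_sym/commr1.
  - move=> uC vC; apply/commr_sym/commrD; last exact: commr_sym.
    by rewrite /GRing.comm -scalerAl -scalerAr uC.
  - by move=> uC vC; apply/commr_sym/commrM; apply: commr_sym.
move=> _ ->; apply: polyEnd_ext => p.
rewrite [LHS]polyEnd_mulE [RHS]polyEnd_mulE !op_e_diagE.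
rewrite linearZ op_H_Xn /= scalerA.
by rewrite coef_deriv coefXM mulr_natr.
Qed.

Lemma idealF_diag0 f : idealF K f -> exists N, forall n, (N <= n)%N ->
  f * op_e K n n = 0 /\ op_e K n n * f = 0.
Proof.
apply: (smallest_sub (X := [set f | exists N, forall n, (N <= n)%N ->
  f * op_e K n n = 0 /\ op_e K n n * f = 0])).
  split=> [|k u v]; rewrite !inE.
    by exists 0%N => n _; rewrite mul0r mulr0.
  move=> [N uN] [M vM]; exists (maxn N M) => n; rewrite geq_max => /andP[].
  move=> /uN[ue eu] /vM[ve ev].
  rewrite mulrDl [op_e _ _ _ * _]mulrDr -scalerAl -scalerAr ue eu ve ev.
  by rewrite scaler0 addr0.
move=> _ [[i j] _ <-] /=; exists (maxn i j).+1 => n.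
rewrite gtn_max => /andP[ni nj].
split; apply: polyEnd_ext => p;
  rewrite polyEnd_mulE !(op_eE char0) coefZ coefXn.
  by rewrite (ltn_eqF nj) mulr0 !mul0r scale0r.
by rewrite (gtn_eqF ni) mulr0 !mul0r scale0r.
Qed.

Lemma comm_HF_diag a : sum_set (subalg_gen [set op_H K]) (idealF K) a ->
  exists N, forall n, (N <= n)%N -> GRing.comm a (op_e K n n).
Proof.
move=> [h hH [f /idealF_diag0[N fN] <-]]; exists N => n /fN[fe ef].
rewrite /GRing.comm mulrDl [op_e _ _ _ * _]mulrDr fe ef !addr0.
exact: comm_H_diag.
Qed.

Section InfiniteOrthogonalFamily.
Context (B : set (polyEnd K)) (B_alg : GRing.subalg_closed (mem B)).
Context (N : nat) (Be : forall n, (N <= n)%N -> B (op_e K n n)).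

Let B0 : B 0.
Proof. by have [/set_mem] := GRing.subalg_closedZ B_alg. Qed.

Let BB u v : B u -> B v -> B (u - v).
Proof.
have [_ /(_ u v)] := GRing.submod_closedB (GRing.subalg_closedZ B_alg).
by rewrite !inE => H Bu Bv; apply: H.
Qed.

Let BM u v : B u -> B v -> B (u * v).
Proof.
by have [_ _ /(_ u v)] := B_alg; rewrite !inE => H Bu Bv; apply: H.
Qed.

(** The common left annihilator in [B] of all [e_kk] with [k >= N + n] increases
    strictly with [n], as the idempotent [e_kk] for [k = N + n] enters it at
    step [n + 1]. *)
Lemma diag_not_left_noetherian : ~ left_noetherian B.
Proof.
pose I_ n := [set u | B u /\ forall k, (N + n <= k)%N -> u * op_e K k k = 0].
move/(_ I_) => [n|n u [Bu u0]|M M_max].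
- split=> [u []//||b u Bb [Bu u0]].
    split; first by rewrite inE; split=> // k _; rewrite mul0r.
    move=> u v; rewrite !inE => -[Bu u0] [Bv v0]; split; first exact: BB.
    by move=> k nk; rewrite mulrBl u0 // v0 // subr0.
  by split=> [|k nk]; [exact: BM | rewrite -mulrA u0 // mulr0].
- by split=> // k nk; apply: u0; apply: leq_trans nk; rewrite addnS.
have : I_ M.+1 (op_e K (N + M) (N + M)).
  split; first by apply/Be/leq_addr.
  move=> k; rewrite addnS => Mk.
  by rewrite op_e_diag_mul ltn_eqF // scale0r.
rewrite M_max // => -[_ /(_ _ (leqnn _))].
by rewrite op_e_diag_mul eqxx scale1r; apply: op_e_diag_neq0.
Qed.

Lemma diag_not_right_noetherian : ~ right_noetherian B.
Proof.
pose I_ n := [set u | B u /\ forall k, (N + n <= k)%N -> op_e K k k * u = 0].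
move/(_ I_) => [n|n u [Bu u0]|M M_max].
- split=> [u []//||b u Bb [Bu u0]].
    split; first by rewrite inE; split=> // k _; rewrite mulr0.
    move=> u v; rewrite !inE => -[Bu u0] [Bv v0]; split; first exact: BB.
    by move=> k nk; rewrite mulrBr u0 // v0 // subr0.
  by split=> [|k nk]; [exact: BM | rewrite mulrA u0 // mul0r].
- by split=> // k nk; apply: u0; apply: leq_trans nk; rewrite addnS.
have : I_ M.+1 (op_e K (N + M) (N + M)).
  split; first by apply/Be/leq_addr.
  move=> k; rewrite addnS => Mk.
  by rewrite op_e_diag_mul gtn_eqF // scale0r.
rewrite M_max // => -[_ /(_ _ (leqnn _))].
by rewrite op_e_diag_mul eqxx scale1r; apply: op_e_diag_neq0.
Qed.

End InfiniteOrthogonalFamily.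
End NotNoetherian.

Theorem corollary5p8 (K : fieldType) (char0 : [pchar K] =i pred0)
    (a : polyEnd K) (aI1 : I1 K a) (a_nonscalar : ~ exists c : K, a = c%:A) :
  let Cen := centralizer (I1 K) a in
  [<-> ~ sum_set (subalg_gen [set op_H K]) (idealF K) a;
       fingen_module (subalg_gen [set a]) Cen;
       left_noetherian Cen;
       right_noetherian Cen;
       fingen_algebra Cen /\ noetherian Cen].
Proof.
move=> Cen.
have Cen_alg : GRing.subalg_closed (mem Cen).
  exact/centralizer_subalg/subalg_genP.
have Cen_a : Cen a by split=> //; apply: commr_refl.
have Cen_comm c : Cen c -> GRing.comm a c by case.
pose HF := sum_set (subalg_gen [set op_H K]) (idealF K).
have fin aHF := centralizer_module_finite char0 aI1 aHF.
have noeth := module_finite_noetherian Cen_alg Cen_a Cen_comm.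
have Cen_e : HF a ->
    exists N, forall n, (N <= n)%N -> Cen (op_e K n n).
  move/(comm_HF_diag char0) => [N aN]; exists N => n /aN.
  by split=> //; apply: op_e_I1.
have left_HF : left_noetherian Cen -> ~ HF a.
  move=> noe /Cen_e[N Ne].
  exact: (diag_not_left_noetherian char0 Cen_alg Ne).
have right_HF : right_noetherian Cen -> ~ HF a.
  move=> noe /Cen_e[N Ne].
  exact: (diag_not_right_noetherian char0 Cen_alg Ne).
tfae.
- by move/fin; apply: module_finite_fingen.
- by move/fingen_module_finite/noeth => -[].
- by move/left_HF/fin/noeth => -[].
- move/right_HF/fin => Cen_fin; split; last exact: noeth.
  exact: module_finite_fingen_algebra Cen_fin.
- by move=> [_ [/left_HF]].
Qed.
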